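(* Let $K\ge2$ be an integer, let $V:\mathbb{R}\to\mathbb{R}$ be a double-well potential satisfying the conditions in the context, and assume that the associated infinite swapping process (for $\boldsymbol{\alpha}\in\Delta$) satisfies a large deviation principle that is uniform with respect to initial conditions. Let $A\subset D\cap[0,\infty)$ be a nonempty closed set, and let $V(A)=\inf_{x\in A}V(x)$. (i) If $h_L\ge2h_R$ or $V(A)\ge h_L$, then $$\sup_{\boldsymbol{\alpha}\in\Delta}\big[\hat r_1(\boldsymbol{\alpha})\wedge\hat r_2(\boldsymbol{\alpha})\big]=2V(A)-(1/2)^{K-1}\big(V(A)\vee h_L\big),$$ with the optimal $\boldsymbol{\alpha}^*=\big(1,1/2,\dots,(1/2)^{K-2},(1/2)^{K-1}\big)\in\Delta$. (ii) If $h_L\le2h_R$ and $V(A)\in[h_L-h_R,h_L]$, then $$\sup_{\boldsymbol{\alpha}\in\Delta}\big[\hat r_1(\boldsymbol{\alpha})\wedge\hat r_2(\boldsymbol{\alpha})\big]=2V(A)-(1/2)^{K-2}\Big(\frac{h_R}{V(A)-(h_L-2h_R)}\Big)V(A),$$ with the optimal $\boldsymbol{\alpha}^*=\Big(1,1/2,\dots,(1/2)^{K-2},\frac{V(A)-(h_L-h_R)}{V(A)-(h_L-2h_R)}(1/2)^{K-2}\Big)$, which lies in $\Delta$ if $V(A)>h_L-h_R$, and lies in the closure of $\Delta$ if $V(A)=h_L-h_R$. Here ''optimal'' means that $\hat r_1\wedge\hat r_2$ (given by the same formulas on the closure of $\Delta$) at $\boldsymbol{\alpha}^*$ equals the sup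remum.
   Context: Conditions on $V$. $V$ is a bounded $C^2$ function, defined on a compact interval $D\subset\mathbb{R}$ and extended periodically to $\mathbb{R}$ as a $C^2$ function. On $D$, $V$ has only two local minima, at $x_L$ and $x_R$, with $V(x_L)<V(x_R)$, and only one local maximum, at $0\in(x_L,x_R)$. Moreover $V(x_L)=0$, $V(0)=h_L$, $V(x_R)=h_L-h_R>0$, and $\inf_{x\in\partial D}V(x)>h_L$. Notation. $\Sigma_K$ is the set of permutations of $\{1,\dots,K\}$; $\Delta=\{(\alpha_1,\dots,\alpha_K)\in\mathbb{R}^K:1=\alpha_1\ge\alpha_2\ge\cdots\ge\alpha_K>0\}$; $a\wedge b=\min(a,b)$, $a\vee b=\max(a,b)$. For $\boldsymbol{\alpha}\in\Delta$ (and by the same formulas on its closure), $$\hat r_1(\boldsymbol{\alpha})=\inf_{\boldsymbol{x}\in A\times\mathbb{R}^{K-1}}\Big[2\sum_{\ell=1}^K\alpha_\ell V(x_\ell)-\min_{\sigma\in\Sigma_K}\Big\{\sum_{\ell=1}^K\alpha_\ell V(x_{\sigma(\ell)})\Big\}\Big],$$ $$\hat r_2(\boldsymbol{\alpha})=\min_{i\in\{2,\dots,K+1\}}\Big\{2V(A)+\Big[\sum_{\ell=1}^{i-2}\alpha_{K-\ell+1}-\alpha_{K-i+2}\Big](h_L-h_R)\Big\}-\alpha_K h_R ,$$ with empty sums equal to $0$. Infinite swapping process. For $\boldsymbol{\alpha}\in\Delta$, with $\boldsymbol{x}_\sigma=(x_{\sigma(1)},\dots,x_{\sigma(K)})$,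 let $$w^{\varepsilon}(\boldsymbol{x};\boldsymbol{\alpha})=\frac{\exp[-\frac1\varepsilon\sum_{\ell}\alpha_\ell V(x_\ell)]}{\sum_{\sigma\in\Sigma_K}\exp[-\frac1\varepsilon\sum_{\ell}\alpha_\ell V(x_{\sigma(\ell)})]},\qquad \rho^\varepsilon_{ij}(\boldsymbol{x};\boldsymbol{\alpha})=\sum_{\sigma:\sigma(j)=i}w^\varepsilon(\boldsymbol{x}_\sigma;\boldsymbol{\alpha}).$$ The infinite swapping process $\boldsymbol{X}^\varepsilon=(X_1^\varepsilon,\dots,X_K^\varepsilon)$ (with periodic boundary conditions on $D^K$) solves $dX_i^\varepsilon=-\nabla V(X_i^\varepsilon)dt+\sqrt{2\varepsilon}\,(\sum_{j=1}^K\rho_{ij}^\varepsilon(\boldsymbol{X}^\varepsilon;\boldsymbol{\alpha})/\alpha_j)^{1/2}dW_i$, $i=1,\dots,K$, with $W_1,\dots,W_K$ independent Wiener processes. It satisfies a uniform large deviation principle if for each $T\in(0,\infty)$ there is a rate function $I_T\ge0$ on path space over $[0,T]$ such that, with $I_{T,\boldsymbol{x}}(\phi)=I_T(\phi)$ if $\phi(0)=\boldsymbol{x}$ and $+\infty$ otherwise, $\bigcup_{\boldsymbol{x}}\{I_{T,\boldsymbol{x}}\le N\}$ is compact for all $N<\infty$, and for every bounded continuous $F$ on path space $\sup_{\boldsymbol{x}}|\varepsilon\log E_{\boldsymbol{x}}e^{-F(\boldsymbol{X}^\varepsilon)/\varepsilon}+\inf_\phi[I_{T,\boldsymbol{x}}(\phi)+F(\phi)]|\to0$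 as $\varepsilon\to0$. *)

(* Defs.v *)
From HB Require Import structures.
From mathcomp Require Import all_boot all_order all_algebra all_fingroup.
From mathcomp Require Import all_classical all_reals all_analysis.

Set Implicit Arguments.
Unset Strict Implicit.
Unset Printing Implicit Defensive.

Import Order.TTheory GRing.Theory Num.Theory.
Import numFieldNormedType.Exports.

Local Open Scope classical_set_scope.
Local Open Scope ring_scope.

Definition is_local_min (R : realType) (V : R -> R) (x : R) :=
  \forall y \near x, V x <= V y.

Definition is_local_max (R : realType) (V : R -> R) (x : R) :=
  \forall y \near x, V y <= V x.

(* D = [a, b], and V stands for its periodic C^2 extension.  The endpoints of
   D are identified and carry the value V a = V b > hL, so they are themselves
   a local maximum of the extension: the uniqueness of the local maximum can
   only be meant in the interior of D. *)
Record double_well (R : realType) (V : R -> R) (a b xL xR hL hR : R) : Prop :=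
  DoubleWell {
    dw_D : a < b ;
    dw_periodic : forall x, V (x + (b - a)) = V x ;
    dw_bounded : [bounded V x | x in setT] ;
    dw_derivable : forall x, derivable V x 1 ;
    dw_derivable2 : forall x, derivable (derive1 V) x 1 ;
    dw_C2 : continuous (derive1n 2 V) ;
    dw_xL_in : a <= xL <= b ;
    dw_xR_in : a <= xR <= b ;
    dw_local_min : forall x, a <= x <= b ->
      is_local_min V x <-> x = xL \/ x = xR ;
    dw_local_max : forall x, a < x < b -> is_local_max V x <-> x = 0 ;
    dw_min_lt : V xL < V xR ;
    dw_order : xL < 0 < xR ;
    dw_xL : V xL = 0 ;
    dw_0 : V 0 = hL ;
    dw_xR : V xR = hL - hR ;
    dw_xR_pos : 0 < hL - hR ;
    dw_boundary : hL < Num.min (V a) (V b)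
  }.

(* The k-th coordinate, counted from 1; it is 0 for k > K. *)
Definition coord (R : realType) (K : nat) (al : 'rV[R]_K) (k : nat) : R :=
  oapp (fun i : 'I_K => al 0 i) 0 (insub k.-1).

Definition Delta (R : realType) (K : nat) : set 'rV[R]_K :=
  [set al | [/\ coord al 1 = 1,
    (forall i j : 'I_K, (i <= j)%N -> al 0 j <= al 0 i) & 0 < coord al K]].
Arguments Delta : clear implicits.

Definition energy (R : realType) (K : nat) (V : R -> R) (al x : 'rV[R]_K) : R :=
  \sum_(l < K) al 0 l * V (x 0 l).

Definition permute (R : realType) (K : nat) (x : 'rV[R]_K) (s : 'S_K) :
    'rV[R]_K :=
  \row_(l < K) x 0 (s l).

Definition min_energy (R : realType) (K : nat) (V : R -> R)
    (al x : 'rV[R]_K) : R :=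
  \big[Num.min/energy V al (permute x 1%g)]_(s : 'S_K)
    energy V al (permute x s).

Definition inf_on (R : realType) (V : R -> R) (A : set R) : R := inf (V @` A).

Definition r1 (R : realType) (K : nat) (V : R -> R) (A : set R)
    (al : 'rV[R]_K) : R :=
  inf [set 2 * energy V al x - min_energy V al x |
       x in [set x : 'rV[R]_K | A (coord x 1)]].

(* The index K - i + 2 is written K + 2 - i, because K - i is truncated
   at i = K + 1. *)
Definition r2_term (R : realType) (K : nat) (VA hL hR : R) (al : 'rV[R]_K)
    (i : nat) : R :=
  2 * VA + (\sum_(1 <= l < i.-1) coord al (K + 1 - l)%N
            - coord al (K + 2 - i)%N) * (hL - hR).

Definition r2 (R : realType) (K : nat) (V : R -> R) (A : set R) (hL hR : R)
    (al : 'rV[R]_K) : R :=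
  \big[Num.min/r2_term (inf_on V A) hL hR al 2]_(2 <= i < K.+2)
    r2_term (inf_on V A) hL hR al i
  - coord al K * hR.

Definition r12 (R : realType) (K : nat) (V : R -> R) (A : set R) (hL hR : R)
    (al : 'rV[R]_K) : R :=
  Num.min (r1 V A al) (r2 V A hL hR al).

Definition weight (R : realType) (K : nat) (V : R -> R) (eps : R)
    (al x : 'rV[R]_K) : R :=
  expR (- (eps^-1 * energy V al x)) /
  \sum_(s : 'S_K) expR (- (eps^-1 * energy V al (permute x s))).

Definition rho (R : realType) (K : nat) (V : R -> R) (eps : R)
    (al x : 'rV[R]_K) (i j : 'I_K) : R :=
  \sum_(s : 'S_K | s j == i) weight V eps al (permute x s).

Definition diffusion (R : realType) (K : nat) (V : R -> R) (eps : R)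
    (al x : 'rV[R]_K) (i : 'I_K) : R :=
  Num.sqrt (2 * eps) * Num.sqrt (\sum_(j < K) rho V eps al x i j / al 0 j).

Definition filtration (R : realType) (d : measure_display)
    (Om : measurableType d) (Ft : R -> set (set Om)) : Prop :=
  [/\ forall t, 0 <= t -> sigma_algebra setT (Ft t),
      forall t, 0 <= t -> Ft t `<=` measurable &
      forall s t, 0 <= s -> s <= t -> Ft s `<=` Ft t].

Definition adapted (R : realType) (d : measure_display)
    (Om : measurableType d) (K : nat) (Ft : R -> set (set Om))
    (X : R -> Om -> 'rV[R]_K) : Prop :=
  forall t, 0 <= t -> forall (i : 'I_K) (B : set R), measurable B ->
    Ft t [set w | B (X t w 0 i)].

Definition continuous_paths (R : realType) (Om : Type) (K : nat)
    (X : R -> Om -> 'rV[R]_K) : Prop :=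
  forall w, {within `[0, +oo[, continuous (fun t => X t w)}.

(* The product rule says at once that the increment W t - W s is independent
   of Ft s, that its K components are independent of each other, and that each
   of them is centred Gaussian with variance t - s (the second parameter of
   normal_prob is the standard deviation). *)
Definition wiener (R : realType) (d : measure_display) (Om : measurableType d)
    (P : probability Om R) (K : nat) (Ft : R -> set (set Om))
    (W : R -> Om -> 'rV[R]_K) : Prop :=
  [/\ adapted Ft W, continuous_paths W, forall w, W 0 w = 0 &
      forall s t, 0 <= s -> s < t -> forall (E : set Om) (B : 'I_K -> set R),
        Ft s E -> (forall i, measurable (B i)) ->
        P (E `&` [set w | forall i, B i ((W t w - W s w) 0 i)]) =
        (P E * \prod_(i < K) normal_prob 0 (Num.sqrt (t - s)) (B i))%E].

(* J is the Ito integral of H against W over [0, t].  For an adapted integrand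
   with continuous paths it is the limit in probability of the left-endpoint
   Riemann sums, which determines it almost surely. *)
Definition ito_integral (R : realType) (d : measure_display)
    (Om : measurableType d) (P : probability Om R) (H W : R -> Om -> R) (t : R)
    (J : Om -> R) : Prop :=
  forall e : R, 0 < e ->
    P [set w | e < `| \sum_(k < n.+1) H (k%:R * t / n.+1%:R) w *
                        (W (k.+1%:R * t / n.+1%:R) w - W (k%:R * t / n.+1%:R) w)
                      - J w |] @[n --> \oo] --> 0%E.

(* The process is represented by its lift to R^K: all coefficients are
   (b - a)-periodic in each coordinate, and the process with periodic boundary
   conditions on D^K is the projection of the lift to the torus. *)
Definition infinite_swapping (R : realType) (d : measure_display)
    (Om : measurableType d) (P : probability Om R) (K : nat)
    (Ft : R -> set (set Om)) (W : R -> Om -> 'rV[R]_K) (V : R -> R) (eps : R)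
    (al x : 'rV[R]_K) (X : R -> Om -> 'rV[R]_K) : Prop :=
  [/\ adapted Ft X, continuous_paths X, forall w, X 0 w = x &
      forall (i : 'I_K) (t : R), 0 <= t ->
        ito_integral P (fun s w => diffusion V eps al (X s w) i)
          (fun s w => W s w 0 i) t
          (fun w => X t w 0 i - x 0 i +
             \int[lebesgue_measure]_(s in `[0, t]) (derive1 V) (X s w 0 i))].

Definition cube (R : realType) (K : nat) (a b : R) : set 'rV[R]_K :=
  [set x | forall i, a <= x 0 i <= b].
Arguments cube : clear implicits.

Definition path_space (R : realType) (K : nat) (T : R) :
    set {uniform` `[0, T] -> 'rV[R]_K} :=
  [set phi : R -> 'rV[R]_K | {within `[0, T], continuous phi}].
Arguments path_space : clear implicits.

(* Path space over the torus (R / p Z)^K: by path lifting, a path in the torus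
   is a path in R^K modulo translation by p Z^K.  Values off [0, T] are
   irrelevant. *)
Definition same_torus_path (R : realType) (K : nat) (T p : R)
    (phi psi : R -> 'rV[R]_K) : Prop :=
  exists k : 'rV[int]_K,
    forall t, 0 <= t <= T -> psi t = phi t + p *: map_mx intr k.

Definition torus_invariant (R : realType) (K : nat) (T p : R) (Y : Type)
    (G : (R -> 'rV[R]_K) -> Y) : Prop :=
  forall phi psi, same_torus_path T p phi psi -> G phi = G psi.

Definition rate_from (R : realType) (K : nat) (I : (R -> 'rV[R]_K) -> \bar R)
    (x : 'rV[R]_K) (phi : R -> 'rV[R]_K) : \bar R :=
  if `[< phi 0 = x >] then I phi else +oo%E.

(* Initial points of the lifts range over the cube D^K, which represents every
   point of the torus. *)
Definition uniform_LDP (R : realType) (d : measure_display)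
    (Om : measurableType d) (P : probability Om R) (K : nat) (a b : R)
    (X : R -> 'rV[R]_K -> R -> Om -> 'rV[R]_K) : Prop :=
  forall T : R, 0 < T ->
  exists I : {uniform` `[0, T] -> 'rV[R]_K} -> \bar R,
  [/\ forall phi, (0 <= I phi)%E,
      torus_invariant T (b - a) I,
      forall N : R, compact (\bigcup_(x in cube R K a b)
        [set phi | path_space R K T phi /\ (rate_from I x phi <= N%:E)%E]
          : set {uniform` `[0, T] -> 'rV[R]_K}) &
      forall F : {uniform` `[0, T] -> 'rV[R]_K} -> R,
        torus_invariant T (b - a) F ->
        [bounded F phi | phi in path_space R K T] ->
        {within path_space R K T, continuous F} ->
        ereal_sup [set `| (eps * ln (\int[P]_w
                              expR (- (F (fun t => X eps x t w) / eps))))%:E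
                          + ereal_inf [set rate_from I x phi + (F phi)%:E
                                      | phi in path_space R K T] |%E
                  | x in cube R K a b] @[eps --> 0^'+] --> 0%E].

Definition alpha_star1 (R : realType) (K : nat) : 'rV[R]_K :=
  \row_(l < K) (1 / 2) ^+ l.
Arguments alpha_star1 : clear implicits.

Definition alpha_star2 (R : realType) (K : nat) (VA hL hR : R) : 'rV[R]_K :=
  \row_(l < K)
    if l.+1 == K then
      (VA - (hL - hR)) / (VA - (hL - 2 * hR)) * (1 / 2) ^+ (K - 2)
    else (1 / 2) ^+ l.
Arguments alpha_star2 : clear implicits.

(* Main.v *)
Require Import Defs.
From mathcomp Require Import all_boot all_order all_algebra all_fingroup.
From mathcomp Require Import all_classical all_reals all_analysis.
From mathcomp Require Import zify ring lra.
Import Order.TTheory GRing.Theory Num.Theory.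
Import numFieldNormedType.Exports.
Local Open Scope classical_set_scope.
Local Open Scope ring_scope.

(** Number the coordinates from 0 and write [t] for the last weight,
    [q = (1/2)^(K-2)], and [gap k] for the sum of the weights after [k] minus
    the weight [k].  Both rates depend on [al] only through [t] and the least
    gap [c]:

      r1 = V(A) (2 + c),    r2 = 2 V(A) + c (hL - hR) - t hR.

    For [r2] this is its definition ([r2E]).  For [r1] ([r1E]), the minimum over
    permutations is reached by sorting the values [V(x_l)] increasingly, so that
    [2 E(x) - min_s E(x_s)] is additive over the superlevel sets of
    [l |-> V(x_l)].  A level set that contains the first particle costs at least
    [2 + gap k] for some [k], a level set that does not costs at least [0], and
    the levels below [V(x_1) >= V(A)] all contain it; this is the lower bound
    [sorted_cost_ge].  It is attained by putting the first particle and the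
    particles after [k] at a minimizer of [V] on [A] and all the others at the
    global minimum [xL].

    The optimization is then two-dimensional.  The last gap is [- t], so
    [c <= - t]; the other gaps let a tail of the weights grow by at most a
    factor 2 (up to [c]) with each added weight, and the tails have to reach the
    weight [1] of the first particle, which forces [c <= t - q]
    ([least_gap_le_geom]).  The vectors [(1, 1/2, ..., q, t)] with
    [0 <= t <= q/2] have least gap [t - q] ([geom_last_least_gap]).  Maximizing
    the minimum of the two affine functions of [(c, t)] under these constraints
    gives [t = q/2] when [hL >= 2 hR] or [V(A) >= hL], and otherwise the [t] at
    which both rates agree.  When [V(A) = hL - hR] that [t] is [0], and the
    supremum is approached along [t -> 0+]. *)

Set Implicit Arguments.
Unset Strict Implicit.

(** * Tails and gaps of a weight vector *)

Definition tail (R : realType) (K : nat) (al : 'rV[R]_K) (k : nat) : R :=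
  \sum_(l < K | (k <= l)%N) al 0 l.

Definition gap (R : realType) (K : nat) (al : 'rV[R]_K) (k : 'I_K) : R :=
  tail al k.+1 - al 0 k.

(** The minimum over [k], as a relation: a minimum over ['I_K] would need a
    default value for [K = 0]. *)
Definition least_gap (R : realType) (K : nat) (al : 'rV[R]_K) (c : R) : Prop :=
  (forall k, c <= gap al k) /\ (exists k, c = gap al k).

(** The closure of [Delta], on which the formulas for the rates still hold. *)
Definition Delta_bar (R : realType) (n : nat) : set 'rV[R]_n.+1 :=
  [set al | [/\ al 0 ord0 = 1,
    (forall i j : 'I_n.+1, (i <= j)%N -> al 0 j <= al 0 i) &
    forall i, 0 <= al 0 i]].

Lemma card_ge_ord (n k : nat) : #|[pred l : 'I_n | (k <= l)%N]| = (n - k)%N.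
Proof.
rewrite -sum1_card (eq_bigl (fun l : 'I_n => (k <= l)%N)) //.
rewrite -(big_mkord (fun l => k <= l)%N (fun=> 1%N)).
case: (leqP k n) => hk.
  have /= <- := big_nat_widenl k 0 n predT (fun=> 1%N) (leq0n k).
  by rewrite sum_nat_const_nat muln1.
rewrite big_nat_cond big1 => [|i]; first by lia.
by move=> /andP[/andP[_ h1] h2]; lia.
Qed.

Lemma tailS (R : realType) (K : nat) (al : 'rV[R]_K) (k : 'I_K) :
  tail al k = al 0 k + tail al k.+1.
Proof.
rewrite /tail (bigD1 k) //=; congr (_ + _); apply: eq_bigl => l.
by rewrite ltn_neqAle andbC eq_sym.
Qed.

Lemma tail_over (R : realType) (K : nat) (al : 'rV[R]_K) : tail al K = 0.
Proof. by apply: big1 => l; rewrite leqNgt ltn_ord. Qed.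

(** The weights decrease, so the last ones are the smallest: exchange the
    elements of [P] before the threshold with the missing ones after it, and
    compare both with the weight at the threshold. *)
Lemma tail_le_sum (R : realType) (K : nat) (al : 'rV[R]_K)
    (mono : forall i j : 'I_K, (i <= j)%N -> al 0 j <= al 0 i)
    (P : pred 'I_K) :
  tail al (K - #|P|) <= \sum_(l | P l) al 0 l.
Proof.
set k := (K - #|P|)%N.
have hP : (#|P| <= K)%N by rewrite -[leqRHS](card_ord K) max_card.
case: (ltnP k K) => hk; last first.
  have h0 : #|P| = 0%N by move: hk hP; rewrite /k; lia.
  by rewrite /k h0 subn0 tail_over big_pred0 // => l; apply: (card0_eq h0).
pose p : 'I_K := Ordinal hk.
have cardU : #|[pred l : 'I_K | k <= l]%N| = #|P|.
  by rewrite card_ge_ord /k; lia.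
rewrite /tail (bigID P) [leRHS](bigID (fun l : 'I_K => k <= l)%N) /=.
rewrite (eq_bigl (fun l : 'I_K => P l && (k <= l)%N)); last first.
  by move=> l; rewrite andbC.
rewrite lerD2l.
apply: (@le_trans _ _ (\sum_(l < K | (k <= l)%N && ~~ P l) al 0 p)).
  by apply: ler_sum => l /andP[hl _]; apply: mono.
apply: (@le_trans _ _ (\sum_(l < K | P l && ~~ (k <= l)%N) al 0 p)); last first.
  by apply: ler_sum => l /andP[_ hl]; apply: mono => /=; lia.
rewrite !sumr_const le_eqVlt; apply/orP; left; apply/eqP; congr (_ *+ _).
have h1 := cardID P [pred l : 'I_K | k <= l]%N.
have h2 := cardID [pred l : 'I_K | k <= l]%N P.
have h3 : #|[predI [pred l : 'I_K | k <= l]%N & P]| =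
          #|[predI P & [pred l : 'I_K | k <= l]%N]|.
  by apply: eq_card => l; rewrite !inE andbC.
have h4 : #|[predD [pred l : 'I_K | k <= l]%N & P]| =
          #|[pred l : 'I_K | (k <= l)%N && ~~ P l]|.
  by apply: eq_card => l; rewrite !inE andbC.
have h5 : #|[predD P & [pred l : 'I_K | k <= l]%N]| =
          #|[pred l : 'I_K | P l && ~~ (k <= l)%N]|.
  by apply: eq_card => l; rewrite !inE andbC.
apply: (@addnI #|[predI P & [pred l : 'I_K | k <= l]%N]|).
by rewrite -{1}h3 -h4 -h5 h1 h2.
Qed.

(** * The cheapest permutation and the rate [r1] *)

Lemma sorting_perm (R : realType) (n : nat) (v : 'I_n.+1 -> R) :
  exists s : 'S_n.+1, forall i j : 'I_n.+1, (i <= j)%N -> v (s i) <= v (s j).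
Proof.
pose e : rel 'I_n.+1 := fun i j => v i <= v j.
pose t := sort e (enum 'I_n.+1).
have st : size t = n.+1 by rewrite size_sort size_enum_ord.
have inj : injective (fun i : 'I_n.+1 => nth ord0 t i).
  move=> i j /eqP; rewrite nth_uniq ?st ?sort_uniq ?enum_uniq //.
  by move=> /eqP/val_inj.
exists (perm inj) => i j hij; rewrite !permE.
have etot : total e by move=> x y; apply: le_total.
have etr : transitive e by move=> x y z; apply: le_trans.
apply: (sorted_leq_nth etr (fun x => lexx (v x)) ord0 (sort_sorted etot _));
  by rewrite ?inE ?st.
Qed.

Lemma Delta_bar_le1 (R : realType) (n : nat) (al : 'rV[R]_n.+1) (l : 'I_n.+1) :
  Delta_bar al -> al 0 l <= 1.
Proof. by case=> <- mono _; apply: mono. Qed.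

Lemma tail_ge0 (R : realType) (n : nat) (al : 'rV[R]_n.+1) (k : nat) :
  Delta_bar al -> 0 <= tail al k.
Proof. by case=> _ _ al0; apply: sumr_ge0 => l _; apply: al0. Qed.

Lemma tail_le_sum_perm (R : realType) (K : nat) (al : 'rV[R]_K)
    (mono : forall i j : 'I_K, (i <= j)%N -> al 0 j <= al 0 i)
    (s : 'S_K) (P : pred 'I_K) :
  tail al (K - #|P|) <= \sum_(l | P l) al 0 (s l).
Proof.
rewrite (reindex_inj (@perm_inj _ (s^-1)%g)) /=.
under eq_bigr do rewrite permKV.
suff -> : #|P| = #|fun l => P ((s^-1)%g l)| by apply: tail_le_sum.
rewrite -!sum1_card [RHS](reindex_inj (@perm_inj _ s)) /=.
by apply: eq_bigl => l; rewrite [RHS]unfold_in permK.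
Qed.

(** After sorting by [s], the upper set [k <= l] is a superlevel set.  If it
    contains the first particle, the weight 1 of that particle is counted, and
    the remaining [n - k] weights are at least the tail after [k]. *)
Lemma sum_upper_gap (R : realType) (n : nat) (al : 'rV[R]_n.+1)
    (hal : Delta_bar al) (s : 'S_n.+1) (k : 'I_n.+1) :
  (k <= (s^-1)%g ord0)%N ->
  2 + gap al k <= \sum_(l < n.+1 | (k <= l)%N) (2 * al 0 (s l) - al 0 l).
Proof.
have [al1 mono _] := hal => hk.
rewrite sumrB -mulr_sumr -/(tail al k) tailS /gap.
rewrite (bigD1 ((s^-1)%g ord0)) //= permKV al1.
set S := \sum_(_ | _ && _) _.
have := tail_le_sum_perm mono s
  (fun l => (k <= l)%N && (l != (s^-1)%g ord0)).
suff -> : (n.+1 -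
    #|fun l : 'I_n.+1 => (k <= l)%N && (l != (s^-1)%g ord0)| = k.+1)%N.
  by rewrite -/S; lra.
have := card_ge_ord n.+1 k; rewrite (cardD1 ((s^-1)%g ord0)) inE hk.
rewrite (eq_card (B := fun l : 'I_n.+1 => (k <= l)%N && (l != (s^-1)%g ord0))).
  by rewrite add1n => h; move: (ltn_ord k) h; set m := #|_|; lia.
by move=> l; rewrite !inE andbC.
Qed.

Lemma sum_upper_ge0 (R : realType) (n : nat) (al : 'rV[R]_n.+1)
    (hal : Delta_bar al) (s : 'S_n.+1) (k : 'I_n.+1) :
  0 <= \sum_(l < n.+1 | (k <= l)%N) (2 * al 0 (s l) - al 0 l).
Proof.
have [_ mono al0] := hal.
rewrite sumrB -mulr_sumr -/(tail al k).
have := tail_le_sum_perm mono s (fun l => (k <= l)%N).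
rewrite (card_ge_ord n.+1 k) subKn 1?ltnW //.
by have := tail_ge0 k hal; lra.
Qed.

Lemma two_add_gap_gt0 (R : realType) (n : nat) (al : 'rV[R]_n.+1)
    (k : 'I_n.+1) :
  Delta_bar al -> 0 < 2 + gap al k.
Proof.
move=> h; have := Delta_bar_le1 k h; have := tail_ge0 k.+1 h.
by rewrite /gap; lra.
Qed.

(** Abel summation: with the values [v (s l)] sorted increasingly, the cost is a
    combination of the costs of the upper sets [k <= l] with coefficients the
    nonnegative increments [dl k]; those up to the position of the first
    particle add up to [v ord0]. *)
Lemma sorted_cost_ge (R : realType) (n : nat) (al : 'rV[R]_n.+1) (c : R)
    (v : 'I_n.+1 -> R) :
  Delta_bar al -> (forall k, c <= gap al k) -> (forall l, 0 <= v l) ->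
  exists s : 'S_n.+1, v ord0 * (2 + c) <=
    2 * (\sum_l al 0 l * v l) - \sum_l al 0 l * v (s l).
Proof.
move=> hal hc v0; have [s hs] := sorting_perm v; exists s.
(* Shifted by one, so that [w 0 = 0] starts the telescoping sum. *)
pose w k := if k is j.+1 then v (s (inord j)) else 0.
pose dl (k : nat) := w k.+1 - w k.
have wE (l : 'I_n.+1) : v (s l) = \sum_(k < n.+1 | (k <= l)%N) dl k.
  rewrite -(big_mkord (fun k => k <= l)%N) (eq_bigl (fun k => k < l.+1)%N) //.
  have -> : \sum_(0 <= k < n.+1 | (k < l.+1)%N) dl k =
      \sum_(0 <= k < l.+1) dl k.
    by rewrite (big_nat_widen 0 l.+1 n.+1).
  by rewrite telescope_sumr // /w subr0 inord_val.
have dl0 (k : 'I_n.+1) : 0 <= dl k.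
  rewrite /dl /w subr_ge0; case: k => [[|k] hk] /=; first exact: v0.
  by apply: hs; rewrite !inordK //; lia.
have -> : 2 * (\sum_l al 0 l * v l) - \sum_l al 0 l * v (s l) =
    \sum_(k < n.+1) dl k *
      \sum_(l < n.+1 | (k <= l)%N) (2 * al 0 (s l) - al 0 l).
  rewrite (reindex_inj (@perm_inj _ s)) /= mulr_sumr -sumrB.
  under [LHS]eq_bigr do rewrite mulrA -mulrBl wE mulr_sumr.
  rewrite (exchange_big_dep predT) //=; apply: eq_bigr => k _.
  by rewrite mulr_sumr; apply: eq_bigr => l _; rewrite mulrC.
have -> : v ord0 = v (s ((s^-1)%g ord0)) by rewrite permKV.
rewrite wE mulr_suml.
rewrite [leRHS](bigID (fun k : 'I_n.+1 => k <= (s^-1)%g ord0)%N) /=.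
rewrite -[leLHS]addr0; apply: lerD.
  apply: ler_sum => k hk; apply: ler_wpM2l => //.
  by apply: le_trans (sum_upper_gap hal hk); rewrite lerD2l.
by apply: sumr_ge0 => k _; apply: mulr_ge0 => //; apply: sum_upper_ge0.
Qed.

Lemma coord1 (R : realType) (n : nat) (al : 'rV[R]_n.+1) :
  Defs.coord al 1 = al 0 ord0.
Proof. by rewrite /Defs.coord (valK ord0). Qed.

Lemma coordS (R : realType) (n : nat) (al : 'rV[R]_n.+1) (k : 'I_n.+1) :
  Defs.coord al k.+1 = al 0 k.
Proof. by rewrite /Defs.coord /= valK. Qed.

Lemma Delta_sub_bar (R : realType) (n : nat) : Delta R n.+1 `<=` @Delta_bar R n.
Proof.
move=> al; rewrite /Delta /= coord1.
rewrite -[X in Defs.coord al X]/((@ord_max n).+1) coordS.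
move=> [a1 mono a0]; split=> // i.
by apply: le_trans (ltW a0) (mono _ _ _); rewrite -ltnS.
Qed.

Lemma exists_least_gap (R : realType) (n : nat) (al : 'rV[R]_n.+1) :
  exists c, least_gap al c.
Proof.
case: (arg_minP (P := predT) (gap al) (erefl : predT (@ord0 n))) => k _ hk.
by exists (gap al k); split; [move=> j; apply: hk | exists k].
Qed.

(** Lower bound: [sorted_cost_ge], since any permutation bounds the minimum from
    above.  Upper bound: for [k] with the least gap, the first particle and
    those after [k] sit at [x0], the others at the zero [z] of [V]; then every
    permutation pays for [n.+1 - k] distinct weights, hence at least the tail
    from [k]. *)
Lemma r1E (R : realType) (n : nat) (V : R -> R) (A : set R)
    (al : 'rV[R]_n.+1) (c x0 z : R) :
  Delta_bar al -> least_gap al c ->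
  (forall x, 0 <= V x) -> V z = 0 -> A x0 -> (forall x, A x -> V x0 <= V x) ->
  r1 V A al = V x0 * (2 + c).
Proof.
move=> hal [hc [k ck]] V0 Vz Ax0 minA; have [al1 mono al0] := hal.
have low : lbound [set 2 * energy V al x - min_energy V al x |
    x in [set x : 'rV[R]_n.+1 | A (Defs.coord x 1)]] (V x0 * (2 + c)).
  move=> _ /= [x Ax <-]; rewrite coord1 in Ax.
  have [s hs] := sorted_cost_ge hal hc (fun l => V0 (x 0 l)).
  apply: (@le_trans _ _ (V (x 0 ord0) * (2 + c))).
    rewrite ler_wpM2r ?minA // ck; exact/ltW/two_add_gap_gt0.
  apply: le_trans hs _; rewrite lerD2l lerN2.
  apply: le_trans (bigmin_le _ s _) _; rewrite /energy.
  by apply: ler_sum => l _; rewrite mxE.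
pose S : pred 'I_n.+1 := fun l => (l == ord0) || (k < l)%N.
pose x : 'rV[R]_n.+1 := \row_l if S l then x0 else z.
have VxE l : V (x 0 l) = (S l)%:R * V x0.
  by rewrite mxE; case: (S l); rewrite ?mul1r ?mul0r.
have cS : (n.+1 - #|S| = k)%N.
  rewrite (cardD1 ord0) unfold_in eqxx /=.
  rewrite (eq_card (B := [pred l : 'I_n.+1 | k < l]%N)).
    by rewrite card_ge_ord; have := ltn_ord k; lia.
  by move=> l; rewrite !inE unfold_in /S; case: eqP => // ->.
have EE : energy V al x = V x0 * (1 + tail al k.+1).
  rewrite /energy (bigD1 ord0) //= al1 VxE /S eqxx /= !mul1r mulrDr mulr1.
  congr (_ + _); rewrite /tail mulr_sumr big_mkcond [RHS]big_mkcond /=.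
  apply: eq_bigr => l _; rewrite VxE /S; case: (l =P ord0) => [->|] //=.
  by case: ifP; rewrite ?mul1r ?mul0r ?mulr0 // mulrC.
have ME : V x0 * tail al k <= min_energy V al x.
  suff h s : V x0 * tail al k <= energy V al (permute x s).
    by apply/bigmin_geP; split.
  have := tail_le_sum_perm mono (s^-1)%g S; rewrite cS => h.
  apply: le_trans (ler_wpM2l (V0 x0) h) _.
  rewrite /energy [leRHS](reindex_inj (@perm_inj _ (s^-1)%g)) /=.
  rewrite mulr_sumr big_mkcond /=; apply: ler_sum => l _.
  rewrite [permute _ _ _ _]mxE permKV VxE.
  by case: (S l); rewrite ?mul1r ?mul0r ?mulr0 // mulrC.
apply/eqP; rewrite eq_le; apply/andP; split; last first.
  apply: lb_le_inf => //; exists (2 * energy V al x - min_energy V al x).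
  by exists x => //=; rewrite coord1 mxE.
apply: (@le_trans _ _ (2 * energy V al x - min_energy V al x)).
  apply: ge_inf; first by exists (V x0 * (2 + c)).
  by exists x => //=; rewrite coord1 mxE.
by rewrite EE ck /gap; move: ME; rewrite tailS; lra.
Qed.

(** * The rate [r2] *)

(** With [K = n.+1], the term of index [i] in the minimum is nondecreasing in
    [gap al (K + 1 - i)] and depends on [al] through it only. *)
Lemma r2E (R : realType) (n : nat) (V : R -> R) (A : set R) (hL hR : R)
    (al : 'rV[R]_n.+1) (c : R) :
  least_gap al c -> 0 <= hL - hR ->
  r2 V A hL hR al =
  2 * inf_on V A + c * (hL - hR) - al 0 ord_max * hR.
Proof.
move=> [hc [k ck]] h0; set VA := inf_on V A.
have termE (j : 'I_n.+1) :
    r2_term VA hL hR al (n.+2 - j) = 2 * VA + gap al j * (hL - hR).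
  rewrite /r2_term; congr (_ + (_ - _) * _); last first.
    rewrite -coordS; congr Defs.coord; have := ltn_ord j; lia.
  have -> : (n.+2 - j).-1 = (n.+1 - j)%N by have := ltn_ord j; lia.
  transitivity (\sum_(j.+1 <= l < n.+1) Defs.coord al l.+1).
    rewrite -[j.+1]add1n [RHS]big_addn [RHS]big_nat_rev.
    apply: eq_big_nat => l hl.
    by congr Defs.coord; have := ltn_ord j; lia.
  rewrite (big_nat_widenl _ 0) //= big_mkord /tail; apply: eq_bigr => l _.
  by rewrite coordS.
congr (_ - _); last by rewrite -coordS.
apply/eqP; rewrite eq_le; apply/andP; split.
  apply: (bigmin_inf_seq _ (n.+2 - k)%N predT) => //.
    by rewrite mem_index_iota; have := ltn_ord k; lia.
  by rewrite termE ck.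
have low i : (2 <= i < n.+3)%N ->
    2 * VA + c * (hL - hR) <= r2_term VA hL hR al i.
  move=> hi; have hj : (n.+2 - i < n.+1)%N by lia.
  have -> : i = (n.+2 - Ordinal hj)%N by rewrite /=; lia.
  by rewrite termE lerD2l ler_wpM2r.
rewrite big_nat_cond; apply: (big_ind (fun y => _ <= y)).
- exact: low.
- by move=> x y hx hy; rewrite le_min hx.
- by move=> i /andP[hi _]; apply: low.
Qed.

(** * Constraints on the least gap *)

Lemma tail_last (R : realType) (n : nat) (al : 'rV[R]_n.+1) :
  tail al n = al 0 ord_max.
Proof. by rewrite (tailS al ord_max) tail_over addr0. Qed.

Lemma least_gap_le_last (R : realType) (n : nat) (al : 'rV[R]_n.+1) (c : R) :
  least_gap al c -> c <= - al 0 ord_max.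
Proof. by case=> hc _; have := hc ord_max; rewrite /gap tail_over sub0r. Qed.

(** [c <= gap k] says that [tail k - c <= 2 (tail k.+1 - c)].  Iterating from
    the last index down to 1 and using [gap 0 = tail 1 - 1] gives
    [1 <= 2 ^+ n * (t - c)]. *)
Lemma least_gap_le_geom (R : realType) (n : nat) (al : 'rV[R]_n.+2) (c : R) :
  al 0 ord0 = 1 -> least_gap al c -> c <= al 0 ord_max - (1 / 2) ^+ n.
Proof.
move=> al1 [hc _]; set t := al 0 ord_max.
have step j : (j <= n)%N -> tail al (n.+1 - j) - c <= 2 ^+ j * (t - c).
  elim: j => [|j IH] hj; first by rewrite subn0 tail_last expr0 mul1r.
  have lt : (n.+1 - j.+1 < n.+2)%N by lia.
  have := hc (Ordinal lt); have := tailS al (Ordinal lt); rewrite /gap /=.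
  have -> : (n.+1 - j.+1).+1 = (n.+1 - j)%N by lia.
  by move: (IH (ltnW hj)); rewrite exprS; lra.
have := step n (leqnn n); rewrite subSnn; have := hc ord0.
rewrite /gap al1 /= => h1 h2.
have h3 : 1 <= 2 ^+ n * (t - c) by lra.
have : (1 / 2) ^+ n * 1 <= (1 / 2) ^+ n * (2 ^+ n * (t - c)).
  by apply: ler_wpM2l => //; rewrite exprn_ge0.
by rewrite mulrA -exprMn divfK ?pnatr_eq0 // expr1n mul1r mulr1; lra.
Qed.

(** The optimal weights have this form: all gaps but the last one are equal, so
    that the constraint of [least_gap_le_geom] is saturated. *)
Definition geom_last (R : realType) (n : nat) (t : R) : 'rV[R]_n.+2 :=
  \row_(l < n.+2) if l.+1 == n.+2 then t else (1 / 2) ^+ l.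

Lemma geom_last_max (R : realType) (n : nat) (t : R) :
  geom_last n t 0 ord_max = t.
Proof. by rewrite mxE eqxx. Qed.

Lemma geom_last_lt (R : realType) (n : nat) (t : R) (l : 'I_n.+2) :
  (l <= n)%N -> geom_last n t 0 l = (1 / 2) ^+ l.
Proof. by move=> h; rewrite mxE ifF //; apply/eqP; lia. Qed.

Lemma geom_last_Delta_bar (R : realType) (n : nat) (t : R) :
  0 <= t <= (1 / 2) ^+ n -> Delta_bar (geom_last n t).
Proof.
move=> /andP[t0 tq]; split.
- by rewrite geom_last_lt // expr0.
- move=> i j hij; have [hi|hi] := leqP i n; last first.
    suff -> : i = j by [].
    by apply: val_inj => /=; have := ltn_ord j; lia.
  have hm k : (k <= n)%N -> (1 / 2 : R) ^+ n <= (1 / 2) ^+ k.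
    by move=> hk; apply: ler_wiXn2l => //; lra.
  rewrite (geom_last_lt t hi); have [hj|hj] := leqP j n.
    by rewrite geom_last_lt //; apply: ler_wiXn2l => //; lra.
  have -> : j = ord_max by apply: val_inj => /=; have := ltn_ord j; lia.
  by rewrite geom_last_max; apply: le_trans tq (hm _ hi).
- by move=> i; rewrite mxE; case: ifP => // _; rewrite exprn_ge0.
Qed.

Lemma Delta_bar_pos (R : realType) (n : nat) (al : 'rV[R]_n.+1) :
  Delta_bar al -> 0 < al 0 ord_max -> Delta R n.+1 al.
Proof.
move=> [a1 mono _] a0; rewrite /Delta /= coord1.
by rewrite -[X in Defs.coord al X]/((@ord_max n).+1) coordS.
Qed.

(** The tail is [t] plus a geometric sum; induction from the last index
    downwards. *)
Lemma geom_last_tail (R : realType) (n : nat) (t : R) (k : nat) :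
  (k <= n)%N ->
  tail (geom_last n t) k.+1 = t + (1 / 2) ^+ k - (1 / 2) ^+ n.
Proof.
move=> hk; rewrite -(subKn hk); move: (n - k)%N (leq_subr k n) => {hk}k.
elim: k => [|k IH] hk; first by rewrite subn0 addrK tail_last geom_last_max.
have lt : ((n - k.+1).+1 < n.+2)%N by lia.
rewrite (tailS _ (Ordinal lt)) geom_last_lt /=; last by lia.
have e : (n - k.+1).+1 = (n - k)%N by lia.
rewrite {2}e IH 1?ltnW // -e exprS; lra.
Qed.

Lemma geom_last_least_gap (R : realType) (n : nat) (t : R) :
  t <= (1 / 2) ^+ n.+1 -> least_gap (geom_last n t) (t - (1 / 2) ^+ n).
Proof.
rewrite exprS => ht.
have gE (k : 'I_n.+2) : (k <= n)%N -> gap (geom_last n t) k = t - (1 / 2) ^+ n.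
  by move=> hk; rewrite /gap geom_last_tail // geom_last_lt //; lra.
split; last by exists ord0; rewrite gE.
move=> k; have [hk|hk] := leqP k n; first by rewrite gE.
have -> : k = ord_max by apply: val_inj => /=; have := ltn_ord k; lia.
by rewrite /gap tail_over geom_last_max; lra.
Qed.

(** * The potential *)

Lemma periodic_mulz (R : realType) (V : R -> R) (p : R) :
  (forall x, V (x + p) = V x) -> forall (k : int) x, V (x + k%:~R * p) = V x.
Proof.
move=> hp.
have hn (m : nat) x : V (x + m%:R * p) = V x.
  elim: m x => [|m IH] x; first by rewrite mul0r addr0.
  by rewrite -natr1 mulrDl mul1r addrA hp IH.
case=> m x; first exact: hn.
by rewrite NegzE mulrNz mulNr -[in RHS](subrK (m.+1%:R * p) x) hn.
Qed.

Lemma double_well_continuous (R : realType) (V : R -> R)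
    (a b xL xR hL hR : R) :
  double_well V a b xL xR hL hR -> continuous V.
Proof.
move=> hV x; have /derivable1_diffP : derivable V x 1 by case: hV.
exact: differentiable_continuous.
Qed.

(** A minimizer over one period is a global minimizer, hence a local one, so it
    is [xL] or [xR]. *)
Lemma double_well_ge0 (R : realType) (V : R -> R) (a b xL xR hL hR : R) :
  double_well V a b xL xR hL hR -> forall x, 0 <= V x.
Proof.
move=> hV; have ab := dw_D hV.
have [c cab cmin] := EVT_min (ltW ab)
  (continuous_subspaceT (double_well_continuous hV)).
have gmin x : V c <= V x.
  have p0 : 0 < b - a by lra.
  have := floor_itv ((x - a) / (b - a)).
  set k := Num.floor _ => /andP[k1 k2].
  rewrite -(periodic_mulz (dw_periodic hV) (- k) x); apply: cmin.
  rewrite in_itv /= mulrNz mulNr.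
  move: k1 k2; rewrite ler_pdivlMr // ltr_pdivrMr // intrD mulrDl mul1r.
  by move=> k1 k2; apply/andP; split; lra.
have cloc : is_local_min V c by apply: filterE; exact: gmin.
have cab' : a <= c <= b by move: cab; rewrite in_itv.
move=> x; apply: le_trans (gmin x).
have [->|->] := (dw_local_min hV cab').1 cloc; first by rewrite (dw_xL hV).
by rewrite (dw_xR hV); exact/ltW/(dw_xR_pos hV).
Qed.

Lemma attained_min (R : realType) (V : R -> R) (a b : R) (A : set R) :
  continuous V -> A `<=` `[a, b] -> A !=set0 -> closed A ->
  exists x0, [/\ A x0, (forall x, A x -> V x0 <= V x) & inf_on V A = V x0].
Proof.
move=> cV Aab A0 Ac.
have cA : compact A by apply: subclosed_compact Ac (@segment_compact _ a b) Aab.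
have [x0 Ax0 minA] := compact_EVT_min A0 cA (continuous_subspaceT cV).
have minA' x : A x -> V x0 <= V x by move=> Ax; apply: minA; rewrite inE.
exists x0; split=> //; first by move: Ax0; rewrite inE.
have Ax : A x0 by move: Ax0; rewrite inE.
have low : lbound (V @` A) (V x0) by move=> _ [x Ax' <-]; apply: minA'.
apply/eqP; rewrite eq_le; apply/andP; split.
  by apply: ge_inf; [exists (V x0) | exists x0].
by apply: lb_le_inf => //; exists (V x0), x0.
Qed.

(** * Optimization over the weights *)

Lemma ereal_sup_approx (R : realType) (T : Type) (D : set T) (f : T -> R)
    (M : R) :
  (forall x, D x -> f x <= M) ->
  (forall e, 0 < e -> exists2 x, D x & M <= f x + e) ->
  ereal_sup [set (f x)%:E | x in D] = M%:E.
Proof.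
move=> hM he; apply/eqP; rewrite eq_le; apply/andP; split.
  by apply: ge_ereal_sup => _ [x Dx <-]; rewrite lee_fin hM.
apply/lee_addgt0Pr => e e0; have [x Dx hx] := he e e0.
apply: (@le_trans _ _ ((f x)%:E + e%:E)%E); first by rewrite -EFinD lee_fin.
by rewrite leeD2r //; apply: ereal_sup_ubound; exists x.
Qed.

Lemma r12E (R : realType) (n : nat) (V : R -> R) (a b xL xR hL hR : R)
    (A : set R) (al : 'rV[R]_n.+1) (c : R) :
  double_well V a b xL xR hL hR ->
  A `<=` `[a, b] -> A !=set0 -> closed A -> Delta_bar al -> least_gap al c ->
  r12 V A hL hR al =
  Num.min (inf_on V A * (2 + c))
          (2 * inf_on V A + c * (hL - hR) - al 0 ord_max * hR).
Proof.
move=> hV Aab A0 Ac hal hc; rewrite /r12.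
have [x0 [Ax0 minA VAE]] := attained_min (double_well_continuous hV) Aab A0 Ac.
rewrite (r1E hal hc (double_well_ge0 hV) (dw_xL hV) Ax0 minA).
by rewrite (r2E V A hc (ltW (dw_xR_pos hV))) VAE.
Qed.

(** Here [p = q / 2].  If [hL <= VA], averaging the two constraints gives
    [c <= - p], which bounds the first rate.  Otherwise the second rate, after
    eliminating [c] with the binding constraint, increases in [t] up to [t = p]
    and decreases from there on. *)
Lemma trade_off_equal (R : realType) (VA hL hR c t p : R) :
  0 <= VA -> 0 < hL - hR -> 2 * hR <= hL \/ hL <= VA ->
  c <= - t -> c <= t - 2 * p ->
  Num.min (VA * (2 + c)) (2 * VA + c * (hL - hR) - t * hR) <=
  2 * VA - p * Num.max VA hL.
Proof.
move=> VA0 h0 hor c1 c2; rewrite ge_min; apply/orP.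
have [hVA|hVA] := leP hL VA; first by left; nra.
have {hor} hh : 2 * hR <= hL by case: hor => //; lra.
right; have [tp|tp] := leP t p.
- have : c * (hL - hR) <= (t - 2 * p) * (hL - hR) by apply: ler_wpM2r c2; lra.
  have : t * (hL - 2 * hR) <= p * (hL - 2 * hR) by apply: ler_wpM2r tp; lra.
  lra.
- have : c * (hL - hR) <= (- t) * (hL - hR) by apply: ler_wpM2r c1; lra.
  have : p * hL <= t * hL by apply: ler_wpM2r (ltW tp); lra.
  lra.
Qed.

(** The combination of the two rates with weights proportional to [2 * hR - hL]
    and [VA] depends on [c] and [t] only through [c - t], which is at most
    [- q]. *)
Lemma trade_off_skewed (R : realType) (VA hL hR c t q : R) :
  0 < hL - hR -> 0 < hR -> hL <= 2 * hR -> hL - hR <= VA ->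
  c <= t - q ->
  Num.min (VA * (2 + c)) (2 * VA + c * (hL - hR) - t * hR) <=
  2 * VA - q * (hR / (VA - (hL - 2 * hR))) * VA.
Proof.
move=> h0 hR0 hh hVA c2.
set M := q * _ * VA.
have den : 0 < VA - (hL - 2 * hR) by lra.
have ME : M * (VA - (hL - 2 * hR)) = q * hR * VA.
  by rewrite /M; field; lra.
rewrite ge_min; apply/orP; have [h|h] := leP M (- c * VA); first by left; lra.
right; have VA0 : 0 < VA by lra.
suff : M <= (- c) * (hL - hR) + t * hR by lra.
rewrite -(ler_pM2r VA0).
have h1 : (- c * VA) * (2 * hR - hL) <= M * (2 * hR - hL).
  by apply: ler_wpM2r (ltW h); lra.
have h2 : (q - t + c) * (hR * VA) <= 0.
  by apply: mulr_le0_ge0; [lra | apply: mulr_ge0; lra].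
lra.
Qed.

Lemma optimal_rates (R : realType) (n : nat) (V : R -> R)
    (a b xL xR hL hR : R) (A : set R) :
  double_well V a b xL xR hL hR ->
  A `<=` `[a, b] -> A !=set0 -> closed A ->
  let VA := inf_on V A in
  let S := ereal_sup [set (r12 V A hL hR al)%:E | al in Delta R n.+2] in
  (2 * hR <= hL \/ hL <= VA ->
     let al := alpha_star1 R n.+2 in
     [/\ S = (2 * VA - (1 / 2) ^+ n.+1 * Num.max VA hL)%:E,
         Delta R n.+2 al & (r12 V A hL hR al)%:E = S]) /\
  (hL <= 2 * hR -> hL - hR <= VA <= hL ->
     let al := alpha_star2 R n.+2 VA hL hR in
     [/\ S = (2 * VA - (1 / 2) ^+ n * (hR / (VA - (hL - 2 * hR))) * VA)%:E,
         (hL - hR < VA -> Delta R n.+2 al),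
         (VA = hL - hR -> closure (Delta R n.+2) al) &
         (r12 V A hL hR al)%:E = S]).
Proof.
move=> hV Aab A0 Ac VA S.
have h0 := dw_xR_pos hV.
have VA0 : 0 <= VA.
  have [x0 [_ _ VAE]] := attained_min (double_well_continuous hV) Aab A0 Ac.
  by rewrite /VA VAE; exact: (double_well_ge0 hV).
pose q : R := (1 / 2) ^+ n; have q0 : 0 < q by rewrite exprn_gt0 //; lra.
have qS : (1 / 2) ^+ n.+1 = q / 2 by rewrite exprS /q; lra.
have r12_Delta al : Delta R n.+2 al -> exists c,
    [/\ c <= - al 0 ord_max, c <= al 0 ord_max - q &
        r12 V A hL hR al = Num.min (VA * (2 + c))
          (2 * VA + c * (hL - hR) - al 0 ord_max * hR)].
  move=> /Delta_sub_bar hal; have [c hc] := exists_least_gap al; exists c.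
  split; [exact: least_gap_le_last | | exact: r12E hV Aab A0 Ac hal hc].
  by apply: least_gap_le_geom => //; case: hal.
(* [c = t - q] is the least gap up to [t = q / 2], where the last gap [- t]
   takes over. *)
have r12_geom t : 0 <= t <= q / 2 -> r12 V A hL hR (geom_last n t) =
    Num.min (VA * (2 + (t - q))) (2 * VA + (t - q) * (hL - hR) - t * hR).
  move=> ht; rewrite -[in t * hR](geom_last_max n t).
  apply: (r12E hV Aab A0 Ac (geom_last_Delta_bar _)).
    by rewrite -/q; lra.
  by apply: geom_last_least_gap; rewrite qS; lra.
have Delta_geom t : 0 < t <= q / 2 -> Delta R n.+2 (geom_last n t).
  move=> ht; apply: Delta_bar_pos; last by rewrite geom_last_max; lra.
  by apply: geom_last_Delta_bar; rewrite -/q; lra.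
split.
  move=> hor al.
  have alE : al = geom_last n (q / 2).
    apply/rowP => l; rewrite !mxE; case: eqP => // h.
    by rewrite -qS; congr (_ ^+ _); lia.
  have Dal : Delta R n.+2 al by rewrite alE; apply: Delta_geom; lra.
  have ral : r12 V A hL hR al = 2 * VA - (1 / 2) ^+ n.+1 * Num.max VA hL.
    rewrite alE r12_geom ?qS; last lra.
    by case: (leP VA hL) => h; [rewrite min_r|rewrite min_l]; nra.
  have SE : S = (2 * VA - (1 / 2) ^+ n.+1 * Num.max VA hL)%:E.
    apply: ereal_sup_approx => [be /r12_Delta[c [c1 c2 ->]]|e e0].
      by rewrite qS; apply: trade_off_equal => //; lra.
    by exists al => //; rewrite ral; lra.
  by split=> //; rewrite SE ral.
move=> hh /andP[hVA1 hVA2] al.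
have hR0 : 0 < hR by lra.
pose den := VA - (hL - 2 * hR); have den0 : 0 < den by rewrite /den; lra.
pose t0 := (VA - (hL - hR)) / den * q.
have alE : al = geom_last n t0.
  by apply/rowP => l; rewrite !mxE subn2.
pose M := 2 * VA - q * (hR / den) * VA.
have t0E : q - t0 = q * (hR / den) by rewrite /t0 /den; field; lra.
have t0q : 0 <= t0 <= q / 2.
  rewrite /t0 mulrAC ler_pdivrMr // divr_ge0 ?(ltW den0) //=.
    by rewrite /den; nra.
  by apply: mulr_ge0; lra.
have ral : r12 V A hL hR al = M.
  have e : 2 * VA + (t0 - q) * (hL - hR) - t0 * hR = VA * (2 + (t0 - q)).
    by rewrite /t0 /den; field; lra.
  rewrite alE r12_geom // e minxx.
  by rewrite /M -t0E; lra.
(* If [t0 = 0] then [geom_last n t0] is not in [Delta], and the last weight has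
   to be moved to a small positive value; [2 * (1 + hR)] makes both the distance
   to [t0] and the loss [t * hR] smaller than [e]. *)
have approx_t e : 0 < e -> exists t, [/\ 0 < t <= q / 2, `|t - t0| < e &
    M <= r12 V A hL hR (geom_last n t) + e].
  move=> e0; have /andP[] := t0q; rewrite le_eqVlt => /predU1P[t00|t0p] t0q'.
    have VAE : VA = hL - hR.
      apply/eqP; rewrite -subr_eq0; apply/eqP.
      have : (VA - (hL - hR)) * (q / den) = 0 by rewrite t00 /t0; field; lra.
      by move/eqP; rewrite mulf_eq0 => /orP[/eqP //|]; rewrite gt_eqF ?divr_gt0.
    have hR1 : 0 < 2 * (1 + hR) by lra.
    pose t := Num.min (q / 2) (e / (2 * (1 + hR))).
    have tp : 0 < t by rewrite lt_min !divr_gt0.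
    have tq : t <= q / 2 by rewrite ge_min lexx.
    have te : t * (2 * (1 + hR)) <= e.
      by rewrite -ler_pdivlMr // ge_min lexx orbT.
    have thR : 0 <= t * hR by apply: mulr_ge0; lra.
    have tVA : 0 <= t * VA by apply: mulr_ge0; lra.
    exists t; split; first by rewrite tp.
      by rewrite -t00 subr0 gtr0_norm //; lra.
    rewrite r12_geom; last by rewrite (ltW tp).
    by rewrite /M -t0E -t00 -VAE -lerBlDr le_min; apply/andP; split; lra.
  exists t0; rewrite t0p subrr normr0 -alE ral; split=> //.
  by rewrite lerDl ltW.
have SE : S = M%:E.
  apply: ereal_sup_approx => [be /r12_Delta[c [c1 c2 ->]]|e e0].
    exact: trade_off_skewed.
  have [t [ht _ hM]] := approx_t e e0.
  by exists (geom_last n t) => //; apply: Delta_geom.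
split=> //; last by rewrite ral SE.
- move=> h; rewrite alE; apply: Delta_geom; case/andP: t0q => _ ->.
  by rewrite andbT /t0; do 2![apply: mulr_gt0 => //]; rewrite ?invr_gt0; lra.
- move=> _; rewrite alE => B /nbhs_ballP[e e0 hB].
  have [t [ht het _]] := approx_t e e0.
  exists (geom_last n t); split; first exact: Delta_geom.
  apply: hB; split=> // i j; rewrite !mxE.
  by case: ifP => _; [rewrite /ball /= distrC | exact: ballxx].
Qed.

Unset Implicit Arguments.

Theorem theorem4p7 (R : realType) (K : nat) (hK : (2 <= K)%N)
  (V : R -> R) (a b xL xR hL hR : R)
  (hV : double_well V a b xL xR hL hR)
  (d : measure_display) (Om : measurableType d) (P : probability Om R)
  (Ft : R -> set (set Om)) (hFt : filtration Ft)
  (W : R -> Om -> 'rV[R]_K) (hW : wiener P Ft W)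
  (X : 'rV[R]_K -> R -> 'rV[R]_K -> R -> Om -> 'rV[R]_K)
  (hX : forall al, Delta R K al -> forall eps, 0 < eps ->
          forall x, cube R K a b x ->
            infinite_swapping P Ft W V eps al x (X al eps x))
  (hLDP : forall al, Delta R K al -> uniform_LDP P a b (X al))
  (A : set R) (hA : A `<=` `[a, b] `&` `[0, +oo[)
  (hA0 : A !=set0) (hAc : closed A) :
  let VA := inf_on V A in
  let S := ereal_sup [set (r12 V A hL hR al)%:E | al in Delta R K] in
  (2 * hR <= hL \/ hL <= VA ->
     let al := alpha_star1 R K in
     [/\ S = (2 * VA - (1 / 2) ^+ (K - 1) * Num.max VA hL)%:E,
         Delta R K al & (r12 V A hL hR al)%:E = S]) /\
  (hL <= 2 * hR -> hL - hR <= VA <= hL ->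
     let al := alpha_star2 R K VA hL hR in
     [/\ S = (2 * VA
              - (1 / 2) ^+ (K - 2) * (hR / (VA - (hL - 2 * hR))) * VA)%:E,
         (hL - hR < VA -> Delta R K al),
         (VA = hL - hR -> closure (Delta R K) al) &
         (r12 V A hL hR al)%:E = S]).
Proof.
have Aab : A `<=` `[a, b] by move=> x /hA[].
clear - hK hV Aab hA0 hAc.
case: K hK => [|[|n]] // _; rewrite subn1 subn2.
exact: optimal_rates hV Aab hA0 hAc.
Qed.
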